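(* Suppose that $K\ge 1$ and that $\beta$ satisfies $$\|D^{(j)}\beta\|_{\ell^\infty_\epsilon}\le C_\beta (K\epsilon)^{-j}\qquad\text{for } j=1,2,3 .$$ Then there exists a constant $C_1=C_1(C_\beta)$, depending only on $C_\beta$, such that $$\langle L^{bqcf}\mathbf{u},\mathbf{u}\rangle\ \ge\ \Big(c_0-C_1\,|\phi''_{2F}|\,\big[K^{-5/2}\epsilon^{-1/2}\big]\Big)\,\|D\mathbf{u}\|_{\ell^2_\epsilon}^2\qquad\text{for all }\mathbf{u}\in\mathcal{U},$$ where $c_0=\min(\phi''_F,\ \phi''_F+4\phi''_{2F})$. Moreover, if $\beta_\ell$ takes both the values $0$ and $1$, then there exist constants $C_2,C_3>0$, independent of $\mathcal{I}$, $N$, $\phi''_F$ and $\phi''_{2F}$ (depending at most on $C_\beta$), such that $$\inf_{\substack{\mathbf{u}\in\mathcal{U}\\ \|D\mathbf{u}\|_{\ell^2_\epsilon}=1}}\langle L^{bqcf}\mathbf{u},\mathbf{u}\rangle\ \le\ \phi''_F+C_2\,|\phi''_{2F}|-C_3\,|\phi''_{2F}|\,\big[K^{-5/2}\epsilon^{-1/2}\big].$$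
   Context: Let $N\ge 1$ be an integer and $\epsilon=1/N$. Let $\mathcal{U}$ be the space of real sequences $\mathbf{u}=(u_\ell)_{\ell\in\mathbb{Z}}$ that are $2N$-periodic ($u_{\ell+2N}=u_\ell$) and have zero mean, $\sum_{\ell=-N+1}^N u_\ell=0$. For a $2N$-periodic sequence $\mathbf{v}$ put $Dv_\ell=(v_\ell-v_{\ell-1})/\epsilon$, $D^{(1)}=D$, $D^{(2)}v_\ell=(Dv_{\ell+1}-Dv_\ell)/\epsilon$, $D^{(3)}v_\ell=(D^{(2)}v_\ell-D^{(2)}v_{\ell-1})/\epsilon$. Norms and inner product: $\|\mathbf{v}\|_{\ell^2_\epsilon}=(\epsilon\sum_{\ell=-N+1}^N|v_\ell|^2)^{1/2}$, $\|\mathbf{v}\|_{\ell^\infty_\epsilon}=\max_{-N+1\le\ell\le N}|v_\ell|$, $\langle\mathbf{u},\mathbf{w}\rangle=\epsilon\sum_{\ell=-N+1}^N u_\ell w_\ell$. Let $\phi$ be a (twice differentiable) pair potential and $F>0$; write $\phi''_F=\phi''(F)$, $\phi''_{2F}=\phi''(2F)$, and assume $\phi''_F>0$. Define $$(L^a\mathbf{v})_\ell=\phi''_F\frac{-v_{\ell+1}+2v_\ell-v_{\ell-1}}{\epsilon^2}+\phi''_{2F}\frac{-v_{\ell+2}+2v_\ell-v_{\ell-2}}{\epsilon^2},$$ $$(L^{qcl}\mathbf{v})_\ell=(\phi''_F+4\phi''_{2F})\frac{-v_{\ell+1}+2v_\ell-v_{\ell-1}}{\epsilon^2}.$$ Let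 $\beta:\mathbb{R}\to[0,1]$ be a $2$-periodic blending function and $\beta_\ell=\beta(\epsilon\ell)$, so that $(\beta_\ell)$ is $2N$-periodic; $D^{(j)}\beta$ denotes the discrete derivatives of the sequence $(\beta_\ell)$. The linearized blended force-based quasicontinuum (B-QCF) operator is $$(L^{bqcf}\mathbf{v})_\ell=\beta_\ell(L^a\mathbf{v})_\ell+(1-\beta_\ell)(L^{qcl}\mathbf{v})_\ell .$$ The blending region is $\mathcal{I}=\{\ell\in\{-N+1,\dots,N\}: 0<\beta_{\ell+j}<1\text{ for some }j\in\{\pm1,\pm2\}\}$, and $K=\#\mathcal{I}$. It is assumed that $D^{(j)}\beta_\ell=0$ for all $\ell\in\{-N+1,\dots,N\}\setminus\mathcal{I}$ and $j\in\{1,2,3\}$. *)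

(* Defs.v *)
From HB Require Import structures.
From mathcomp Require Import all_boot all_order all_algebra.
From mathcomp Require Import all_classical all_reals all_analysis.

Set Implicit Arguments.
Unset Strict Implicit.
Unset Printing Implicit Defensive.

Import Order.TTheory GRing.Theory Num.Theory numFieldNormedType.Exports.
Local Open Scope ring_scope.

Definition eps (R : realType) (N : nat) : R := N%:R^-1.

(* The 2N sites -N+1, ..., N of one period. *)
Definition site (N : nat) (i : 'I_(2 * N)) : int := (i : nat)%:Z - N%:Z + 1.

Section LatticeFunctions.
Variables (R : realType) (N : nat).
Implicit Types u v w : int -> R.

Definition periodic v : Prop := forall l : int, v (l + (2 * N)%N%:Z) = v l.

Definition zero_mean v : Prop := \sum_(i < 2 * N) v (site i) = 0.

Definition displacements : set (int -> R) :=
  fun u => periodic u /\ zero_mean u.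

(* D1 and D3 are backward differences (of v and D2 v); D2 is the forward
   difference of D1 v, i.e. the centred second difference. *)
Definition D1 v : int -> R := fun l => (v l - v (l - 1)) / eps R N.
Definition D2 v : int -> R := fun l => (D1 v (l + 1) - D1 v l) / eps R N.
Definition D3 v : int -> R := fun l => (D2 v l - D2 v (l - 1)) / eps R N.

Definition inner u w : R :=
  eps R N * \sum_(i < 2 * N) u (site i) * w (site i).

Definition l2norm v : R :=
  Num.sqrt (eps R N * \sum_(i < 2 * N) `|v (site i)| ^+ 2).

Definition linfnorm v : R := \big[Num.max/0]_(i < 2 * N) `|v (site i)|.

(* In the operators, p1 and p2 stand for phi''(F) and phi''(2F). *)
Definition La (p1 p2 : R) v : int -> R := fun l =>
  p1 * ((- v (l + 1) + 2 * v l - v (l - 1)) / eps R N ^+ 2) +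
  p2 * ((- v (l + 2) + 2 * v l - v (l - 2)) / eps R N ^+ 2).

Definition Lqcl (p1 p2 : R) v : int -> R := fun l =>
  (p1 + 4 * p2) * ((- v (l + 1) + 2 * v l - v (l - 1)) / eps R N ^+ 2).

Definition Lbqcf (b : int -> R) (p1 p2 : R) v : int -> R := fun l =>
  b l * La p1 p2 v l + (1 - b l) * Lqcl p1 p2 v l.

Definition sample (beta : R -> R) : int -> R :=
  fun l => beta (eps R N * l%:~R).

Definition blending_region (b : int -> R) : {set 'I_(2 * N)} :=
  finset (fun i : 'I_(2 * N) =>
    has (fun j : int => 0 < b (site i + j) < 1) [:: 1; -1; 2; -2]).

End LatticeFunctions.

Definition twice_differentiable_potential (R : realType) (phi : R -> R) : Prop :=
  forall x : R, 0 < x ->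
    derivable phi x 1 /\ derivable (derive1 phi) x 1.

Definition blending_function (R : realType) (beta : R -> R) : Prop :=
  (forall x, 0 <= beta x <= 1) /\ (forall x, beta (x + 2) = beta x).

Definition derivatives_supported (R : realType) (N : nat) (b : int -> R) : Prop :=
  forall i : 'I_(2 * N), i \notin blending_region N b ->
    [/\ D1 N b (site i) = 0, D2 N b (site i) = 0 & D3 N b (site i) = 0].

Definition derivatives_bounded (R : realType) (N : nat) (C : R)
    (b : int -> R) : Prop :=
  let h := #|blending_region N b|%:R * eps R N in
  [/\ linfnorm N (D1 N b) <= C * h ^- 1,
      linfnorm N (D2 N b) <= C * h ^- 2 &
      linfnorm N (D3 N b) <= C * h ^- 3].

(* Main.v *)
Require Import Defs.
From HB Require Import structures.
From mathcomp Require Import all_boot all_order all_algebra.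
From mathcomp Require Import all_classical all_reals all_analysis.
From mathcomp Require Import zify ring lra.
Import Order.TTheory GRing.Theory Num.Theory numFieldNormedType.Exports.
Local Open Scope classical_set_scope.
Local Open Scope ring_scope.

Set Implicit Arguments.
Unset Strict Implicit.
Unset Printing Implicit Defensive.

(** Write e = 1/N, h = K e for the width of the blending region, n = |Du|^2,
    p1 and p2 for the two stiffnesses, and q = K^(-5/2) e^(-1/2).

    The operator differs from the local one by -p2 e^2 b D^4, with D^4 the
    fourth difference.  Summation by parts turns its energy into
<<
      (p1 + 4 p2) n - p2 e^2 <b D2 u, D2 u> + p2 (strain) + p2 (displacement)
>>
    ([bqcf_energyE]).  The first two terms lie between c0 n and
    (p1 + 4 |p2|) n because e^2 |D2 u|^2 <= 4 |Du|^2.  The strain term is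
    e^2 times a sum of D2 b against products of strains, hence of size
    C K^-2 n.  The displacement term e^2 <D3 b, u Du> involves u itself: with
    |u|_oo <= sqrt 2 |Du| and the fact that D3 b lives on K sites, the
    Cauchy-Schwarz inequality gives e^2 h^-3 h^(1/2) n = q n up to a constant.
    As K <= 2N, K^-2 is at most a multiple of q, and coercivity follows
    ([bqcf_coercive]).

    For the upper bound, the displacement term has to be made as large as that
    estimate allows.  When b takes the values 0 and 1, its total variation
    is at least 1; estimating b by Db, Db by D2 b and D2 b by D3 b, each time
    over at most K sites, yields |D3 b|^2 >= h^-5 ([D3_sqr_ge]).  Let v be a
    smooth zero-mean wave and take u = v (1 + s h^(5/2) D2 b) minus its mean,
    with s a sign.  The correction contributes s h^(5/2) v D3 b to Du, which
    has bounded norm, and makes the displacement term equal to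
    s e^2 h^(5/2) <v^2, |D3 b|^2> up to a bounded error
    ([modulated_test_function]).  Since cos^2 + sin^2 = 1, one of the two waves
    v = cos (pi x), v = sin (pi x) captures half of |D3 b|^2, wherever the
    blending region is located and however many pieces it has; the gain is
    then e^2 h^(5/2) h^-5 / 2 = q / 2, with the sign opposite to p2
    ([bqcf_unstable_mode]).  When q is below the size of the error, any
    test function will do. *)

(** * Summation over one period *)

Section DiscreteIntegral.
Context {R : realType} (N : nat).
Hypothesis N_gt0 : (0 < N)%N.
Implicit Types (f g : int -> R) (l m k : int).

Local Notation e := (eps R N).

Definition dint f : R := e * \sum_(i < 2 * N) f (site i).

Lemma eps_gt0 : 0 < e.
Proof. by rewrite invr_gt0 ltr0n. Qed.

Lemma eps_neq0 : e != 0.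
Proof. by rewrite gt_eqF ?eps_gt0. Qed.

Lemma dint_cst (c : R) : dint (fun=> c) = 2 * c.
Proof.
rewrite /dint sumr_const card_ord -[c *+ _]mulr_natl natrM mulrA mulrCA.
by rewrite mulVf ?mulr1 // pnatr_eq0 -lt0n.
Qed.

Lemma eq_dint f g : (forall l, f l = g l) -> dint f = dint g.
Proof. by move=> fg; congr (_ * _); apply: eq_bigr. Qed.

Lemma dintD f g : dint (fun l => f l + g l) = dint f + dint g.
Proof. by rewrite /dint big_split mulrDr. Qed.

Lemma dintZ (c : R) f : dint (fun l => c * f l) = c * dint f.
Proof. by rewrite /dint -mulr_sumr mulrCA. Qed.

Lemma le_dint f g : (forall i : 'I_(2 * N), f (site i) <= g (site i)) ->
  dint f <= dint g.
Proof. by move=> fg; rewrite ler_pM2l ?eps_gt0 //; apply: ler_sum. Qed.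

Lemma dint_ge0 f : (forall i : 'I_(2 * N), 0 <= f (site i)) -> 0 <= dint f.
Proof. by move=> f0; rewrite mulr_ge0 ?(ltW eps_gt0) // sumr_ge0. Qed.

Lemma dint_eq0 f : (forall i : 'I_(2 * N), 0 <= f (site i)) -> dint f = 0 ->
  forall i : 'I_(2 * N), f (site i) = 0.
Proof.
move=> f0 /eqP; rewrite mulf_eq0 (negPf eps_neq0) /= => /eqP s0 i.
by apply: (psumr_eq0P _ s0).
Qed.

Lemma ler_norm_dint f : `|dint f| <= dint (fun l => `|f l|).
Proof.
by rewrite /dint normrM (gtr0_norm eps_gt0) ler_pM2l ?eps_gt0 // ler_norm_sum.
Qed.

(** Nonnegativity of the integral of (c f - b g)^2, with c and b the integrals of
    g^2 and f g; if c = 0 then g vanishes at every site. *)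
Lemma dint_Cauchy_Schwarz f g :
  dint (fun l => f l * g l) ^+ 2 <=
  dint (fun l => f l ^+ 2) * dint (fun l => g l ^+ 2).
Proof.
set b := dint _; set a := dint (fun l => f l ^+ 2).
set c := dint (fun l => g l ^+ 2).
have c0 : 0 <= c by apply: dint_ge0 => i; apply: sqr_ge0.
have [cE|cN0] := eqVneq c 0.
  have g0 i : g (@site N i) = 0.
    have /eqP := dint_eq0 (fun=> sqr_ge0 _) cE i.
    by rewrite sqrf_eq0 => /eqP.
  by rewrite /b /dint big1 ?mulr0 ?expr0n ?cE ?mulr0 // => i _; rewrite g0 mulr0.
have : 0 <= dint (fun l => (c * f l - b * g l) ^+ 2).
  by apply: dint_ge0 => i; apply: sqr_ge0.
rewrite (@eq_dint _ (fun l => c ^+ 2 * f l ^+ 2 + ((- (2 * b * c)) * (f l * g l) +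
  b ^+ 2 * g l ^+ 2))); last by move=> l; ring.
rewrite !dintD !dintZ -/a -/b -/c => h.
have {h}: 0 <= c * (c * a - b ^+ 2) by move: h; congr (_ <= _); ring.
by rewrite pmulr_rge0 ?lt0r ?cN0 ?c0 // subr_ge0 mulrC.
Qed.

Lemma periodicMz f k l : Defs.periodic N f -> f (l + k * (2 * N)%N%:Z) = f l.
Proof.
move=> pf; suff H n l' : f (l' + n%:Z * (2 * N)%N%:Z) = f l'.
  case: k => n; first exact: H.
  by rewrite NegzE -(H n.+1 (l + _)); congr f; ring.
elim: n l' => [|n IH] l'; first by rewrite mul0r addr0.
by rewrite -[RHS]IH -[RHS]pf; congr f; rewrite intS; ring.
Qed.

(** The representative does not depend on the periodic function, so several
    functions can be moved to the same site simultaneously. *)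
Lemma siteP l : exists i : 'I_(2 * N), forall f, Defs.periodic N f -> f l = f (site i).
Proof.
have d0 : ((2 * N)%N%:Z != 0) by lia.
pose z := l + N%:Z - 1.
have ilt : (`|(z %% (2 * N)%N%:Z)%Z|%N < 2 * N)%N.
  have := ltz_pmod z (_ : 0 < (2 * N)%N%:Z); have := modz_ge0 z d0; lia.
exists (Ordinal ilt) => f pf.
rewrite -[RHS](periodicMz (z %/ (2 * N)%N%:Z)%Z _ pf); congr f.
rewrite /site /=; have := divz_eq z (2 * N)%N%:Z; have := modz_ge0 z d0.
rewrite /z; lia.
Qed.

Lemma periodic_shift f k : Defs.periodic N f -> Defs.periodic N (fun l => f (l + k)).
Proof. by move=> pf l /=; rewrite addrAC pf. Qed.

Lemma dint_telescope f : Defs.periodic N f -> dint (fun l => f (l + 1) - f l) = 0.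
Proof.
move=> pf; pose a n : R := f (n%:Z - N%:Z + 1).
rewrite /dint (eq_bigr (fun i : 'I_(2 * N) => a i.+1 - a i)); last first.
  by move=> i _; congr (f _ - f _); rewrite /site intS; ring.
rewrite -(big_mkord xpredT (fun n => a n.+1 - a n)) telescope_sumr //.
suff -> : a (2 * N)%N = a 0%N by rewrite subrr mulr0.
by rewrite /a -[RHS]pf; congr f; lia.
Qed.

Lemma dint_shift1 f : Defs.periodic N f -> dint (fun l => f (l + 1)) = dint f.
Proof.
move=> pf; apply/eqP; rewrite -subr_eq0 -[X in _ - X]mul1r -mulNr -dintZ -dintD.
by apply/eqP; rewrite -[RHS](dint_telescope pf); apply: eq_dint => l; rewrite mulN1r.
Qed.

Lemma D1E f l : f l - f (l - 1) = e * D1 N f l.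
Proof. by rewrite /D1 mulrC divfK ?eps_neq0. Qed.

Lemma periodic_D1 f : Defs.periodic N f -> Defs.periodic N (D1 N f).
Proof. by move=> pf l; rewrite /D1 addrAC !pf. Qed.

(** Inside one period, f l - f m is a sum of consecutive differences, and every
    difference of the period occurs at most once. *)
Lemma periodic_oscillation f l m : Defs.periodic N f ->
  `|f l - f m| <= dint (fun k => `|D1 N f k|).
Proof.
move=> pf; have [i fi] := siteP l; have [j fj] := siteP m.
rewrite (fi f pf) (fj f pf) => {l m fi fj}.
wlog ij : i j / (j <= i)%N => [H|].
  by have [/H//|/ltnW/H] := leqP j i; rewrite distrC.
pose a n : R := f (n%:Z - N%:Z + 1).
rewrite -[f (site i)]/(a i) -[f (site j)]/(a j) -telescope_sumr //.
apply: le_trans (ler_norm_sum _ _ _) _.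
have -> : dint (fun k => `|D1 N f k|) = \sum_(0 <= k < 2 * N) `|a k.+1 - a k|.
  rewrite -(@dint_shift1 (fun k => `|D1 N f k|)); last first.
    by move=> k; rewrite periodic_D1.
  rewrite /dint mulr_sumr big_mkord; apply: eq_bigr => k _.
  rewrite -[in LHS](gtr0_norm eps_gt0) -normrM -D1E /a /site; congr `|_|.
  by congr (f _ - f _); rewrite ?intS; ring.
have i2 : (i <= 2 * N)%N by apply: ltnW.
rewrite [leRHS](big_cat_nat (n := i)) //= [X in _ <= X + _](big_cat_nat (n := j)) //=.
rewrite -addrA addrCA lerDl addr_ge0 ?sumr_ge0 //.
Qed.

(** f l is the mean over the period of the oscillations f l - f k. *)
Lemma discrete_Poincare f l : Defs.periodic N f -> zero_mean N f ->
  `|f l| <= dint (fun k => `|D1 N f k|).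
Proof.
move=> pf zf; set X := dint _.
have : `|dint (fun k => f l + (-1) * f k)| <= dint (fun=> X).
  apply: le_trans (ler_norm_dint _) _; apply: le_dint => i.
  by rewrite mulN1r periodic_oscillation.
rewrite dintD dintZ !dint_cst [dint f]/dint [X in e * X]zf mulr0 mulr0 addr0.
by rewrite normrM gtr0_norm // ler_pM2l.
Qed.

End DiscreteIntegral.
Arguments eq_dint {R N f} g.

(** * The energy after summation by parts *)

Section EnergyIdentity.
Context {R : realType} (N : nat).
Hypothesis N_gt0 : (0 < N)%N.
Implicit Types (f u b : int -> R) (l : int).

Local Notation e := (eps R N).

Lemma l2normE f : l2norm N f ^+ 2 = dint N (fun l => f l ^+ 2).
Proof.
rewrite /l2norm sqr_sqrtr.
  by congr (_ * _); apply: eq_bigr => i _; rewrite real_normK ?num_real.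
by rewrite mulr_ge0 ?(ltW (eps_gt0 N_gt0)) // sumr_ge0 // => i _; apply: exprn_ge0.
Qed.

Lemma zero_meanE f : zero_mean N f <-> dint N f = 0.
Proof.
split=> [zf|/eqP]; first by rewrite /dint [X in _ * X]zf mulr0.
by rewrite mulf_eq0 (negPf (eps_neq0 N_gt0)) => /eqP.
Qed.

Lemma zero_mean_D1 f : Defs.periodic N f -> zero_mean N (D1 N f).
Proof.
move=> pf; apply/zero_meanE.
rewrite -[RHS](mulr0 e^-1) -(dint_telescope N_gt0 (periodic_shift (-1) pf)) -dintZ.
by apply: eq_dint => l; rewrite addrK mulrC.
Qed.

Lemma zero_mean_D2 f : Defs.periodic N f -> zero_mean N (D2 N f).
Proof.
move=> pf; apply/zero_meanE.
rewrite -[RHS](proj1 (zero_meanE _) (zero_mean_D1 (periodic_D1 pf))).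
rewrite -(dint_shift1 N_gt0 (periodic_D1 (periodic_D1 pf))).
by apply: eq_dint => l; rewrite /D2 [X in _ = X]/D1 addrK.
Qed.

Lemma periodic_D2 f : Defs.periodic N f -> Defs.periodic N (D2 N f).
Proof. by move=> pf l; rewrite /D2 addrAC !periodic_D1. Qed.

Lemma periodic_D3 f : Defs.periodic N f -> Defs.periodic N (D3 N f).
Proof. by move=> pf l; rewrite /D3 addrAC !periodic_D2. Qed.

Definition blended_curvature b u :=
  e ^+ 2 * dint N (fun l => b l * D2 N u l ^+ 2).
Definition strain_coupling b u :=
  e ^+ 2 * dint N (fun l => D2 N b l * (D1 N u (l + 1) * D1 N u l + D1 N u l ^+ 2)).
(** The only part of the energy that sees u itself and not just its
    differences; it produces the rate K^(-5/2) e^(-1/2) in both directions. *)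
Definition displacement_coupling b u :=
  e ^+ 2 * dint N (fun l => D3 N b l * (u (l - 1) * D1 N u l)).

(** Both sides are sums over a period, and their summands differ by G (l + 1) - G l
    with G periodic.  The sum of Db_l (Du_l)^2 is one of the telescoping parts,
    which is why only second and third differences of b remain. *)
Lemma bqcf_energyE b u (p1 p2 : R) : Defs.periodic N b -> Defs.periodic N u ->
  inner N (Lbqcf N b p1 p2 u) u =
  (p1 + 4 * p2) * l2norm N (D1 N u) ^+ 2 +
  p2 * (strain_coupling b u + displacement_coupling b u - blended_curvature b u).
Proof.
move=> pb pu.
(* The four lines come from the parts integrations of: the second difference of
   u against u; D^4 u against b u, moving one D^2; the cross terms Db Du of
   D^2 (b u); and D2 u against u D2 b. *)
pose G l := - (p1 + 4 * p2) * ((u l - u (l - 1)) * u (l - 1) / e) / e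
  + p2 * (D2 N u (l - 1) * (b l * u l) - b (l - 1) * u (l - 1) * D2 N u l)
  - p2 * e * (D1 N b l * D1 N u l ^+ 2)
  - p2 * e * (D1 N u l * (D2 N b (l - 1) * u (l - 1))).
have pG : Defs.periodic N G.
  move=> l; rewrite /G.
  have -> : l + (2 * N)%N%:Z - 1 = l - 1 + (2 * N)%N%:Z by ring.
  by rewrite !(periodic_D1, periodic_D2, pb, pu).
rewrite l2normE /strain_coupling /displacement_coupling /blended_curvature.
transitivity (dint N (fun l => (p1 + 4 * p2) * D1 N u l ^+ 2 +
   (p2 * e ^+ 2 * (D2 N b l * (D1 N u (l + 1) * D1 N u l + D1 N u l ^+ 2)) +
   (p2 * e ^+ 2 * (D3 N b l * (u (l - 1) * D1 N u l)) +
   (- (p2 * e ^+ 2) * (b l * D2 N u l ^+ 2) + (G (l + 1) - G l))))));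
  last by rewrite 4!dintD !dintZ (dint_telescope N_gt0 pG); ring.
rewrite -[LHS]/(dint N (fun l => Lbqcf N b p1 p2 u l * u l)).
apply: eq_dint => l.
rewrite /G /Lbqcf /La /Lqcl /D3 /D2 /D1.
have [E1 E2 E3 E4] : [/\ l + 1 + 1 = l + 2, l + 1 - 1 = l, l - 1 + 1 = l & l - 1 - 1 = l - 2].
  by split; ring.
have E5 : l + 2 - 1 = l + 1 by ring.
rewrite !(E1, E2, E3, E4, E5).
by field; exact: (eps_neq0 N_gt0).
Qed.

Lemma bqcf_energyZ b u (p1 p2 : R) (c : R) :
  inner N (Lbqcf N b p1 p2 (fun l => c * u l)) (fun l => c * u l) =
  c ^+ 2 * inner N (Lbqcf N b p1 p2 u) u.
Proof.
rewrite -[LHS]/(dint N (fun l => Lbqcf N b p1 p2 (fun k => c * u k) l * (c * u l))).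
rewrite -[inner _ _ u]/(dint N (fun l => Lbqcf N b p1 p2 u l * u l)) -dintZ.
by apply: eq_dint => l; rewrite /Lbqcf /La /Lqcl; ring.
Qed.

End EnergyIdentity.

(** * Slowly varying waves of zero mean *)

Section Waves.
Context {R : realType}.
Implicit Types (f df : R -> R) (x y : R).

Lemma lipschitz1_of_derivative f df x y :
  (forall z : R, is_derive z 1 f (df z)) -> (forall z, `|df z| <= 1) ->
  `|f x - f y| <= `|x - y|.
Proof.
move=> fd d1; wlog yx : x y / y <= x => [H|].
  by have [/H//|/ltW/H] := leP y x; rewrite distrC [`|y - x|]distrC.
have [c _ ->] : exists2 c, c \in `[y, x]%R & f x - f y = df c * (x - y).
  apply: MVT_segment => //.
  apply: continuous_subspaceT => z; apply: differentiable_continuous.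
  by apply/derivable1_diffP; have [] := fd z.
by rewrite normrM ler_piMl.
Qed.

Lemma lipschitz_cos x y : `|cos x - cos y| <= `|x - y|.
Proof.
apply: (@lipschitz1_of_derivative _ (fun z => - sin z)) => z.
by rewrite normrN sin_max.
Qed.

Lemma lipschitz_sin x y : `|sin x - sin y| <= `|x - y|.
Proof. by apply: (@lipschitz1_of_derivative _ cos) => z; exact: cos_max. Qed.

Definition wave (N : nat) f (l : int) : R := f (pi * (eps R N * l%:~R)).

(** The antiperiodicity of f over pi makes the wave change sign under a shift by
    half a period; this gives at once the period 2N and the zero mean. *)
Lemma waveP (N : nat) f : (0 < N)%N ->
  (forall x, f (x + pi) = - f x) -> (forall x y, `|f x - f y| <= `|x - y|) ->
  [/\ Defs.periodic N (wave N f), zero_mean N (wave N f) &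
      forall l, `|D1 N (wave N f) l| <= pi].
Proof.
move=> N0 fpi flip.
have half l : wave N f (l + N%:Z) = - wave N f l.
  rewrite -fpi /wave; congr f; rewrite intrD mulrDr mulrDr.
  by rewrite /eps mulVf ?mulr1 // pnatr_eq0 -lt0n.
have pw : Defs.periodic N (wave N f).
  by move=> l; rewrite mul2n -addnn PoszD addrA !half opprK.
split=> // [|l].
  apply/(zero_meanE N0).
  have sh n : dint N (fun l => wave N f (l + n%:Z)) = dint N (wave N f).
    elim: n => [|n IH]; first by apply: eq_dint => l; rewrite addr0.
    rewrite -IH -(dint_shift1 N0 (periodic_shift n%:Z pw)).
    by apply: eq_dint => l; rewrite -addrA -intS.
  have : dint N (wave N f) = - dint N (wave N f).
    rewrite -[LHS](sh N) -mulN1r -dintZ; apply: eq_dint => l.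
    by rewrite half mulN1r.
  by move=> E; lra.
have e0 := eps_gt0 (R := R) N0.
rewrite /D1 normrM [X in _ * X]ger0_norm ?invr_ge0 ?(ltW e0) // ler_pdivrMr //.
apply: le_trans (flip _ _) _.
rewrite -mulrBr -mulrBr -intrB opprB addrC subrK mulr1.
by rewrite ger0_norm // mulr_ge0 ?pi_ge0 // ltW.
Qed.

End Waves.

(** * Estimates in terms of the width of the blending region *)

Lemma ler_normM (R : realDomainType) (x y a b : R) :
  `|x| <= a -> `|y| <= b -> `|x * y| <= a * b.
Proof. by move=> xa yb; rewrite normrM ler_pM. Qed.

Section BlendedEnergy.
Context {R : realType} (N : nat) (C : R) (b : int -> R).
Hypothesis N_gt0 : (0 < N)%N.
Hypothesis C_ge0 : 0 <= C.
Hypothesis b_periodic : Defs.periodic N b.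
Hypothesis b_01 : forall l, 0 <= b l <= 1.
Hypothesis b_supp : derivatives_supported N b.
Hypothesis K_gt0 : (0 < #|blending_region N b|)%N.
Hypothesis b_bound : derivatives_bounded N C b.
Implicit Types (f u v : int -> R) (l m : int).

Local Notation e := (eps R N).
Local Notation I := (blending_region N b).
Local Notation K := (#|I|%:R : R).

(** The square root of the width K e makes all the exponents of the estimates
    integers: with r this root, the rate K^(-5/2) e^(-1/2) is e^2 / r^5. *)
Definition root_width : R := Num.sqrt (K * e).
Local Notation r := root_width.

Let e_gt0 : 0 < e := eps_gt0 N_gt0.

Lemma width_gt0 : 0 < K * e.
Proof. by rewrite mulr_gt0 // ltr0n. Qed.

Lemma root_width_gt0 : 0 < r.
Proof. by rewrite sqrtr_gt0 width_gt0. Qed.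

Lemma sqr_root_width : r ^+ 2 = K * e.
Proof. by rewrite sqr_sqrtr // ltW // width_gt0. Qed.

Lemma width_le2 : r ^+ 2 <= 2.
Proof.
rewrite sqr_root_width ler_pdivrMr ?ltr0n // -natrM ler_nat.
by apply: leq_trans (max_card _) _; rewrite card_ord.
Qed.

Lemma root_width_le2 : r <= 2.
Proof. by have := width_le2; have := root_width_gt0; nra. Qed.

Lemma eps_le_width : e <= r ^+ 2.
Proof. by rewrite sqr_root_width ler_peMl ?(ltW e_gt0) // ler1n. Qed.

Lemma le_linfnorm f l : Defs.periodic N f -> `|f l| <= linfnorm N f.
Proof.
move=> pf; have [i fi] := @siteP R N N_gt0 l; rewrite (fi f pf).
exact: (le_bigmax 0 (fun j : 'I_(2 * N) => `|f (site j)|) i).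
Qed.

Lemma D2_bound l : `|D2 N b l| <= C / r ^+ 4.
Proof.
have [_ H _] := b_bound; rewrite (exprM r 2 2) sqr_root_width.
exact: le_trans (le_linfnorm l (periodic_D2 b_periodic)) H.
Qed.

Lemma D3_bound l : `|D3 N b l| <= C / r ^+ 6.
Proof.
have [_ _ H] := b_bound; rewrite (exprM r 2 3) sqr_root_width.
exact: le_trans (le_linfnorm l (periodic_D3 b_periodic)) H.
Qed.

Lemma dint_supp_le f (a : R) :
  (forall i : 'I_(2 * N), i \in I -> f (site i) <= a) ->
  (forall i : 'I_(2 * N), i \notin I -> f (site i) = 0) ->
  dint N f <= r ^+ 2 * a.
Proof.
move=> fI fNI; rewrite sqr_root_width mulrAC [leRHS]mulrC ler_pM2l //.
rewrite (bigID (mem I)) /= [X in _ + X]big1 ?addr0 //.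
by rewrite mulr_natl -sumr_const; apply: ler_sum.
Qed.

(** The factor e^2 / r^4 is K^-2. *)
Lemma strain_coupling_le u : Defs.periodic N u ->
  `|strain_coupling N b u| <= 2 * C * (e ^+ 2 / r ^+ 4) * l2norm N (D1 N u) ^+ 2.
Proof.
move=> pu; rewrite l2normE //; set n := dint N _.
rewrite /strain_coupling normrM ger0_norm ?sqr_ge0 //.
rewrite (_ : _ * n = e ^+ 2 * (C / r ^+ 4 * (2 * n))); last by ring.
rewrite ler_pM2l ?exprn_gt0 //; apply: le_trans (ler_norm_dint N_gt0 _) _.
have <- : dint N (fun l => 2^-1 * D1 N u (l + 1) ^+ 2 + 3 / 2 * D1 N u l ^+ 2) = 2 * n.
  rewrite dintD !dintZ (dint_shift1 N_gt0 (f := fun l => D1 N u l ^+ 2)) -/n; first by field.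
  by move=> l; rewrite periodic_D1.
rewrite -dintZ; apply: (le_dint N_gt0) => i.
apply: ler_normM; first exact: D2_bound.
move: (D1 N u _) (D1 N u _) => x y.
have := sqr_ge0 (x - y); have := sqr_ge0 (x + y); have := sqr_ge0 y.
by rewrite ler_norml => ? ? ?; apply/andP; split; nra.
Qed.

(** The constant 4 is exactly the one in p1 + 4 p2: for p2 > 0 the curvature term
    takes away at most what the factor 4 p2 adds, which leaves c0 = p1. *)
Lemma blended_curvature_bounds u : Defs.periodic N u ->
  0 <= blended_curvature N b u <= 4 * l2norm N (D1 N u) ^+ 2.
Proof.
move=> pu; rewrite l2normE //; apply/andP; split.
  apply: mulr_ge0; first exact: sqr_ge0.
  apply: (dint_ge0 N_gt0) => i; apply: mulr_ge0; last exact: sqr_ge0.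
  by case/andP: (b_01 (site i)).
set n := dint N _.
have <- : dint N (fun l => 2 * D1 N u (l + 1) ^+ 2 + 2 * D1 N u l ^+ 2) = 4 * n.
  rewrite dintD !dintZ (dint_shift1 N_gt0 (f := fun l => D1 N u l ^+ 2)) -/n; first by ring.
  by move=> l; rewrite periodic_D1.
rewrite /blended_curvature -dintZ; apply: (le_dint N_gt0) => i.
rewrite mulrCA -exprMn /D2 [e * _]mulrC divfK ?gt_eqF //.
have /andP[] := b_01 (site i).
move: (b _) (D1 N u _) (D1 N u _) => t y x; rewrite /= => t0 t1.
have : t * (x - y) ^+ 2 <= (x - y) ^+ 2 by rewrite ler_piMl ?sqr_ge0.
by move=> H; apply: le_trans H _; have := sqr_ge0 (x + y); nra.
Qed.

(** The factor 2 is the length of the period. *)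
Lemma sup_norm_le u l : displacements N u -> `|u l| ^+ 2 <= 2 * l2norm N (D1 N u) ^+ 2.
Proof.
case=> pu zu; have X := discrete_Poincare N_gt0 l pu zu.
apply: (@le_trans _ _ (dint N (fun k => 1 * `|D1 N u k|) ^+ 2)).
  rewrite (eq_dint (fun k => `|D1 N u k|)) => [|k]; last by rewrite mul1r.
  by rewrite lerXn2r ?nnegrE // (le_trans _ X).
apply: le_trans (dint_Cauchy_Schwarz N_gt0 (fun=> 1) _) _.
rewrite dint_cst // expr1n mulr1 l2normE //.
by rewrite (eq_dint (fun l => D1 N u l ^+ 2)) // => k; rewrite real_normK ?num_real.
Qed.

Lemma D3_sqr_le : dint N (fun l => `|D3 N b l| ^+ 2) <= C ^+ 2 / r ^+ 10.
Proof.
have r0 := root_width_gt0.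
rewrite (_ : _ / _ = r ^+ 2 * (C / r ^+ 6) ^+ 2); last by field; rewrite gt_eqF.
apply: dint_supp_le => i iI.
  by rewrite lerXn2r ?nnegrE ?divr_ge0 ?exprn_ge0 ?(ltW r0) // D3_bound.
by case: (b_supp iI) => _ _ ->; rewrite normr0 expr0n.
Qed.

Definition rate : R := e ^+ 2 / r ^+ 5.

(** The displacement is estimated in the supremum norm, and D3 b, being supported on
    K sites, has square norm at most (C h^-3)^2 h. *)
Lemma displacement_coupling_le u : displacements N u ->
  `|displacement_coupling N b u| <=
    2 * C * rate * l2norm N (D1 N u) ^+ 2.
Proof.
move=> du; set n := l2norm N (D1 N u) ^+ 2; have r0 := root_width_gt0.
have n0 : 0 <= n by apply: sqr_ge0.
rewrite /displacement_coupling /rate normrM ger0_norm ?sqr_ge0 //.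
rewrite (_ : _ * n = e ^+ 2 * (2 * C / r ^+ 5 * n)); last by ring.
rewrite ler_pM2l ?exprn_gt0 //; apply: le_trans (ler_norm_dint N_gt0 _) _.
set s := Num.sqrt (2 * n).
have s0 : 0 <= s by apply: sqrtr_ge0.
have s2 : s ^+ 2 = 2 * n by rewrite sqr_sqrtr // mulr_ge0.
pose J := dint N (fun l => `|D3 N b l| * `|D1 N u l|).
apply: (@le_trans _ _ (s * J)).
  rewrite -dintZ; apply: (le_dint N_gt0) => i.
  rewrite !normrM mulrCA ler_wpM2r ?mulr_ge0 //.
  by rewrite -(@ler_pXn2r _ 2) ?nnegrE // s2 sup_norm_le.
have J0 : 0 <= J by apply: (dint_ge0 N_gt0) => i; rewrite mulr_ge0.
have JJ : J ^+ 2 <= C ^+ 2 / r ^+ 10 * n.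
  apply: le_trans (dint_Cauchy_Schwarz N_gt0 _ _) _.
  rewrite /n l2normE // (eq_dint (f := fun l => `|D1 N u l| ^+ 2) (fun l => D1 N u l ^+ 2)).
    by rewrite ler_wpM2r ?D3_sqr_le // (dint_ge0 N_gt0) // => i; apply: sqr_ge0.
  by move=> l; rewrite real_normK ?num_real.
have X0 : 0 <= 2 * C / r ^+ 5 * n.
  by rewrite mulr_ge0 // divr_ge0 ?exprn_ge0 ?(ltW r0) // mulr_ge0.
have n20 : 0 <= 2 * n by rewrite mulr_ge0.
rewrite -(@ler_pXn2r _ 2) ?nnegrE //; last by rewrite mulr_ge0.
rewrite exprMn s2; apply: le_trans (ler_wpM2l n20 JJ) _.
have Y0 : 0 <= C ^+ 2 * n ^+ 2 / r ^+ 10.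
  by rewrite divr_ge0 ?exprn_ge0 ?(ltW r0) // mulr_ge0 // sqr_ge0.
rewrite -subr_ge0 (_ : _ - _ = 2 * (C ^+ 2 * n ^+ 2 / r ^+ 10)).
  by rewrite mulr_ge0.
by field; rewrite gt_eqF.
Qed.

(** The transition from 0 to 1 forces |Db| >= 1/h somewhere; then, since D b and
    D2 b have zero mean and their differences live on K sites, |D2 b| >= h^-2
    somewhere and the l1 norm of D3 b is at least h^-2.  Cauchy-Schwarz on the
    support turns this into the lower bound h^-5 for the square norm. *)
Lemma D3_sqr_ge : (exists l, b l = 0) -> (exists m, b m = 1) ->
  r ^- 10 <= dint N (fun l => D3 N b l ^+ 2).
Proof.
move=> [l0 bl0] [l1 bl1]; have r0 := root_width_gt0.
set A := dint N _; set X := dint N (fun l => `|D3 N b l|).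
have X0 : 0 <= X by apply: (dint_ge0 N_gt0).
have XA : X ^+ 2 <= r ^+ 2 * A.
  (* The indicator of the support of D3 b costs one factor h. *)
  have -> : X = dint N (fun l => (D3 N b l != 0)%:R * `|D3 N b l|).
    by apply: eq_dint => l; have [->|] := eqVneq; rewrite ?normr0 ?mulr0 ?mul1r.
  apply: le_trans (dint_Cauchy_Schwarz N_gt0 _ _) _.
  rewrite (eq_dint (f := fun l => `|D3 N b l| ^+ 2) (fun l => D3 N b l ^+ 2)); last first.
    by move=> l; rewrite real_normK ?num_real.
  rewrite ler_wpM2r ?(dint_ge0 N_gt0) // => [i|]; first exact: sqr_ge0.
  rewrite -[leRHS]mulr1; apply: dint_supp_le => i iI.
    by case: (_ != 0); rewrite ?expr1n ?expr0n.
  by case: (b_supp iI) => _ _ ->; rewrite eqxx expr0n.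
have D2X l : `|D2 N b l| <= X.
  apply: (discrete_Poincare N_gt0 l (periodic_D2 b_periodic)).
  exact: zero_mean_D2.
have D1X l : `|D1 N b l| <= r ^+ 2 * X.
  have zD1 := zero_mean_D1 N_gt0 b_periodic.
  apply: le_trans (discrete_Poincare N_gt0 l (periodic_D1 b_periodic) zD1) _.
  rewrite -(dint_shift1 N_gt0 (f := fun k => `|D1 N (D1 N b) k|)); last first.
    by move=> k; rewrite periodic_D1 //; apply: periodic_D1.
  apply: dint_supp_le => i iI; rewrite [D1 N (D1 N b) _]/D1 addrK; first exact: D2X.
  by have [_ D2z _] := b_supp iI; rewrite -[X in `|X|]/(D2 N b (site i)) D2z normr0.
have osc : 1 <= r ^+ 2 * (r ^+ 2 * X).
  have := periodic_oscillation N_gt0 l1 l0 b_periodic.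
  rewrite bl1 bl0 subr0 normr1 => /le_trans; apply.
  apply: dint_supp_le => i iI; first exact: D1X.
  by case: (b_supp iI) => -> _ _; rewrite normr0.
have r2 : 0 < r ^+ 2 by rewrite exprn_gt0.
rewrite -[_ ^- _]mul1r ler_pdivrMr ?exprn_gt0 //.
apply: le_trans (_ : (r ^+ 2 * (r ^+ 2 * X)) ^+ 2 <= _).
  by rewrite exprn_ege1.
rewrite (_ : _ ^+ 2 = r ^+ 8 * X ^+ 2); last by ring.
rewrite (_ : A * _ = r ^+ 8 * (r ^+ 2 * A)); last by ring.
by rewrite ler_pM2l ?exprn_gt0.
Qed.

(** Bound for Dv (1 + s r^5 D2 b) when |Dv| <= V; here r^5 |D2 b| <= C r <= 2 C. *)
Definition modulated_slope_bound (V : R) : R := V * (1 + 2 * C).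
(** K^2 times the error in the energy of the modulated wave: the support has
    measure r^2, |D3 b| <= C / r^6, and the last factor bounds what D3 b is
    multiplied by, 1 + 6 C being a bound for the test function. *)
Definition remainder_bound (V : R) : R :=
  C * ((1 + 6 * C) * modulated_slope_bound V + 3 * C ^+ 2).

Definition test_norm_bound (V : R) : R := 4 * modulated_slope_bound V ^+ 2 + 2 * C ^+ 2.

(** The amplitude r^5 = h^(5/2) is the largest for which the part r^5 v D3 b of the
    strain keeps a bounded norm.  It makes the displacement coupling collect
    the definite term r^5 v^2 |D3 b|^2, while the correction r^5 v D2 b of the
    displacement itself is only of order r, so all other terms are O(K^-2). *)
Lemma modulated_test_function v (s V : R) :
  Defs.periodic N v -> zero_mean N v -> (forall l, `|v l| <= 1) ->
  (forall l, `|D1 N v l| <= V) -> s ^+ 2 = 1 ->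
  exists u, [/\ displacements N u,
    l2norm N (D1 N u) ^+ 2 <= test_norm_bound V &
    e ^+ 2 * r ^+ 5 * dint N (fun l => v (l - 1) ^+ 2 * D3 N b l ^+ 2)
      - remainder_bound V <= s * displacement_coupling N b u].
Proof.
move=> pv zv v1 vV s2; have r0 := root_width_gt0; have rle2 := root_width_le2.
have V0 : 0 <= V by apply: le_trans (vV 0).
have r_neq0 : r != 0 by rewrite gt_eqF.
have s1 : `|s| = 1.
  by apply/eqP; rewrite -(@eqrXn2 _ 2) // real_normK ?num_real // s2 expr1n.
pose g l := D2 N b l; pose mu := dint N (fun l => v l * g l) / 2.
pose t l := 1 + s * r ^+ 5 * g l.
pose u l := v l * t l - s * r ^+ 5 * mu.
have pg : Defs.periodic N g by exact: periodic_D2.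
have pu : Defs.periodic N u by move=> l; rewrite /u /t pv pg.
have zu : zero_mean N u.
  apply/(zero_meanE N_gt0).
  rewrite (eq_dint (fun l => v l + ((s * r ^+ 5) * (v l * g l) + - (s * r ^+ 5 * mu)))).
    rewrite 2!dintD dintZ dint_cst // (proj1 (zero_meanE N_gt0 v) zv) /mu.
    by field.
  by move=> l; rewrite /u /t; ring.
have gC l : r ^+ 5 * `|g l| <= C * r.
  rewrite mulrC -ler_pdivlMr ?exprn_gt0 //; apply: le_trans (D2_bound l) _.
  by rewrite [leRHS](_ : _ = C / r ^+ 4) //; field.
have Cr : C * r <= 2 * C by rewrite mulrC ler_wpM2r.
have t_le l : `|t l| <= 1 + 2 * C.
  apply: le_trans (ler_normD _ _) _; rewrite normr1 lerD2l 2!normrM s1 mul1r.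
  by rewrite (ger0_norm (exprn_ge0 _ (ltW r0))) (le_trans (gC l)).
have mu_le : `|mu| <= C / r ^+ 2.
  rewrite /mu normrM [X in _ * X]ger0_norm // ler_pdivrMr //.
  apply: le_trans (ler_norm_dint N_gt0 _) _.
  apply: (@le_trans _ _ (r ^+ 2 * (C / r ^+ 4))); last first.
    have X0 : 0 <= C / r ^+ 2 by rewrite divr_ge0 ?exprn_ge0 ?(ltW r0).
    by rewrite [leLHS](_ : _ = C / r ^+ 2); [rewrite ler_peMr ?ler1n|field].
  apply: dint_supp_le => i iI.
    by rewrite -[leRHS]mul1r ler_normM // D2_bound.
  by have [_ D2z _] := b_supp iI; rewrite /g D2z mulr0 normr0.
have rmu3 : r ^+ 5 * `|mu| <= C * r ^+ 3.
  rewrite mulrC -ler_pdivlMr ?exprn_gt0 // (le_trans mu_le) //.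
  by rewrite [leRHS](_ : _ = C / r ^+ 2) //; field.
have rmu : r ^+ 5 * `|mu| <= 4 * C.
  apply: le_trans rmu3 _.
  have r3 : r ^+ 3 <= 4 by have := width_le2; nra.
  by rewrite [leRHS]mulrC ler_wpM2l.
have D1u l : D1 N u l = D1 N v l * t l + s * r ^+ 5 * (v (l - 1) * D3 N b l).
  rewrite /u /t /D3 -/(g l) -/(g (l - 1)) /D1; field.
  exact: eps_neq0.
have Dvt l : `|D1 N v l * t l| <= modulated_slope_bound V by rewrite ler_normM.
exists u; split=> //.
- rewrite l2normE //.
  apply: (@le_trans _ _ (dint N (fun l =>
    2 * modulated_slope_bound V ^+ 2 + 2 * r ^+ 10 * `|D3 N b l| ^+ 2))).
    apply: (le_dint N_gt0) => i; rewrite D1u.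
    have := Dvt (site i); have := v1 (site i - 1).
    move: (D1 N v _ * _) (v _) (D3 N b _) => x y z y1 xV.
    have x2 : x ^+ 2 <= modulated_slope_bound V ^+ 2.
      by rewrite -(real_normK (num_real x)) lerXn2r ?nnegrE ?(le_trans _ xV).
    have y2 : y ^+ 2 <= 1.
      by rewrite -(real_normK (num_real y)) expr_le1.
    have z2 : (r ^+ 5 * (y * z)) ^+ 2 <= r ^+ 10 * `|z| ^+ 2.
      rewrite real_normK ?num_real // (_ : _ ^+ 2 = y ^+ 2 * (r ^+ 10 * z ^+ 2)); last by ring.
      by rewrite ler_piMl // mulr_ge0 ?sqr_ge0 ?exprn_ge0 // ltW.
    have : (x + s * r ^+ 5 * (y * z)) ^+ 2 <= 2 * x ^+ 2 + 2 * (r ^+ 5 * (y * z)) ^+ 2.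
      have := sqr_ge0 (x - s * (r ^+ 5 * (y * z))).
      rewrite -subr_ge0 => q; rewrite -subr_ge0; apply: le_trans q _.
      rewrite subr0 -subr_ge0.
      rewrite (_ : _ - _ = (1 - s ^+ 2) * 2 * (r ^+ 5 * (y * z)) ^+ 2); last by ring.
      by rewrite s2 subrr !mul0r.
    by move=> H; apply: le_trans H _; rewrite -mulrA lerD // ler_pM2l.
  rewrite dintD dint_cst // dintZ mulrA -mulrA lerD //; first by rewrite mulrA -natrM.
  rewrite -mulrA ler_pM2l // mulrC -ler_pdivlMr ?exprn_gt0 //.
  exact: D3_sqr_le.
(* Splitting off the definite term; what remains is D3 b times a bounded factor,
   because u - v = s r^5 (v D2 b - mu). *)
have eqB l : s * (D3 N b l * (u (l - 1) * D1 N u l)) =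
  r ^+ 5 * (v (l - 1) ^+ 2 * D3 N b l ^+ 2) +
  s * D3 N b l * (u (l - 1) * (D1 N v l * t l) +
     (r ^+ 5 * (g (l - 1) * v (l - 1) - mu)) * (r ^+ 5 * (v (l - 1) * D3 N b l))).
  rewrite D1u /u /t.
  transitivity (s ^+ 2 * r ^+ 5 * (v (l - 1) ^+ 2 * D3 N b l ^+ 2) +
  s * D3 N b l * ((v (l - 1) * (1 + s * r ^+ 5 * g (l - 1)) - s * r ^+ 5 * mu) *
      (D1 N v l * (1 + s * r ^+ 5 * g l)) + s ^+ 2 * 
     (r ^+ 5 * (g (l - 1) * v (l - 1) - mu)) * (r ^+ 5 * (v (l - 1) * D3 N b l)))).
    by ring.
  by rewrite s2 !mul1r.
pose Z l := s * D3 N b l * (u (l - 1) * (D1 N v l * t l) +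
     (r ^+ 5 * (g (l - 1) * v (l - 1) - mu)) * (r ^+ 5 * (v (l - 1) * D3 N b l))).
have E : s * displacement_coupling N b u =
   e ^+ 2 * r ^+ 5 * dint N (fun l => v (l - 1) ^+ 2 * D3 N b l ^+ 2) + e ^+ 2 * dint N Z.
  rewrite /displacement_coupling mulrCA -[in LHS]dintZ [X in _ * X = _](eq_dint _ eqB) dintD dintZ.
  by rewrite /Z; ring.
rewrite E lerD2l lerNl.
have ZR : dint N (fun l => `|Z l|) <= r ^+ 2 * (C / r ^+ 6 *
    ((1 + 6 * C) * modulated_slope_bound V + 3 * C ^+ 2)).
  apply: dint_supp_le => i iI; last first.
    by have [_ _ D3z] := b_supp iI; rewrite /Z D3z mulr0 mul0r normr0.
  rewrite /Z; apply: ler_normM.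
    by rewrite normrM s1 mul1r D3_bound.
  apply: le_trans (ler_normD _ _) _; apply: lerD.
    apply: ler_normM (Dvt _); apply: le_trans (ler_normB _ _) _.
    rewrite (_ : 1 + 6 * C = 1 * (1 + 2 * C) + 4 * C); last by ring.
    apply: lerD; first exact: ler_normM.
    by rewrite 2!normrM s1 mul1r ger0_norm ?exprn_ge0 // ltW.
  apply: (@le_trans _ _ ((C * r + C * r ^+ 3) * (C / r))); last first.
    rewrite (_ : _ * (C / r) = C ^+ 2 * (1 + r ^+ 2)); last by field.
    by rewrite [leRHS]mulrC ler_wpM2l ?sqr_ge0 //; have := width_le2; lra.
  apply: ler_normM; rewrite normrM ger0_norm ?exprn_ge0 ?(ltW r0) //.
    apply: (@le_trans _ _ (r ^+ 5 * (`|g (site i - 1)| + `|mu|))).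
      rewrite ler_pM2l ?exprn_gt0 //; apply: le_trans (ler_normB _ _) _.
      by rewrite lerD2r normrM ler_piMr.
    rewrite mulrDr lerD //.
  rewrite mulrC -ler_pdivlMr ?exprn_gt0 // -[leRHS]mul1r ler_normM //.
  by apply: le_trans (D3_bound _) _; rewrite [leRHS](_ : _ = C / r ^+ 6) //; field.
rewrite -mulrN (le_trans (_ : _ <= e ^+ 2 * dint N (fun l => `|Z l|))) //.
  rewrite ler_pM2l ?exprn_gt0 //; apply: le_trans (ler_norm_dint N_gt0 _).
  by rewrite -normrN ler_norm.
apply: le_trans (ler_wpM2l (sqr_ge0 _) ZR) _.
have -> : e ^+ 2 * (r ^+ 2 * (C / r ^+ 6 * ((1 + 6 * C) * modulated_slope_bound V + 3 * C ^+ 2)))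
  = e ^+ 2 / (r ^+ 2) ^+ 2 * remainder_bound V by rewrite /remainder_bound; field.
have S0 : 0 <= modulated_slope_bound V by rewrite mulr_ge0 // addr_ge0 // mulr_ge0.
rewrite ler_piMl //; last first.
  rewrite ler_pdivrMr ?exprn_gt0 // mul1r.
  by rewrite lerXn2r ?nnegrE ?(ltW e_gt0) ?sqr_ge0 ?eps_le_width.
by rewrite mulr_ge0 // addr_ge0 // mulr_ge0 ?sqr_ge0 // addr_ge0 // mulr_ge0.
Qed.

(** * Coercivity and the unstable mode *)

Lemma rate_gt0 : 0 < rate.
Proof. by rewrite divr_gt0 ?exprn_gt0 ?root_width_gt0. Qed.

Lemma inv_card_sqr_le1 : e ^+ 2 / r ^+ 4 <= 1.
Proof.
rewrite ler_pdivrMr ?exprn_gt0 ?root_width_gt0 // mul1r (exprM r 2 2).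
by rewrite lerXn2r ?nnegrE ?(ltW e_gt0) ?sqr_ge0 // eps_le_width.
Qed.

(** K^-2 = r e^2 / r^5, and r is bounded because K <= 2 N. *)
Lemma inv_card_sqr_le_rate : e ^+ 2 / r ^+ 4 <= 2 * rate.
Proof.
have r0 := root_width_gt0.
have -> : e ^+ 2 / r ^+ 4 = r * rate by rewrite /rate; field; rewrite gt_eqF.
by rewrite ler_wpM2r ?root_width_le2 // ltW // rate_gt0.
Qed.

(** For p2 >= 0 the curvature term is dominated by 4 p2 n, for p2 < 0 it has the
    good sign; the two couplings contribute 4 C + 2 C to the constant. *)
Lemma bqcf_coercive u (p1 p2 : R) : displacements N u ->
  (Num.min p1 (p1 + 4 * p2) - 6 * C * `|p2| * rate) * l2norm N (D1 N u) ^+ 2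
    <= inner N (Lbqcf N b p1 p2 u) u.
Proof.
move=> du; have [pu _] := du; rewrite bqcf_energyE //.
have n0 : 0 <= l2norm N (D1 N u) ^+ 2 by apply: sqr_ge0.
have /ler_normlP[s1 s2] :
    `|strain_coupling N b u| <= 4 * C * rate * l2norm N (D1 N u) ^+ 2.
  apply: le_trans (strain_coupling_le pu) _; rewrite ler_wpM2r //.
  have -> : 4 * C * rate = 2 * C * (2 * rate) by ring.
  by rewrite ler_wpM2l ?mulr_ge0 // inv_card_sqr_le_rate.
have /ler_normlP[d1 d2] := displacement_coupling_le du.
have /andP[k1 k2] := blended_curvature_bounds pu.
move: (l2norm N _ ^+ 2) n0 (strain_coupling N b u) s1 s2
  (displacement_coupling N b u) d1 d2 (blended_curvature N b u) k1 k2
  => n n0 s s1 s2 d d1 d2 k k1 k2.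
rewrite mulrBl.
have -> : 6 * C * `|p2| * rate * n = `|p2| * (6 * C * rate * n) by ring.
have [p2_ge0|p2_lt0] := leP 0 p2.
  rewrite ger0_norm // min_l; last by lra.
  have : 0 <= p2 * (4 * n + (s + d - k) + 6 * C * rate * n).
    by rewrite mulr_ge0 //; lra.
  by lra.
rewrite ltr0_norm // min_r; last by lra.
have : 0 <= - p2 * (k - (s + d) + 6 * C * rate * n).
  by rewrite mulr_ge0 //; lra.
by lra.
Qed.

(** Everything in the energy except the displacement coupling is at most
    p1 + (8 + 2 C) |p2| per unit of |Du|^2, so the choice of u only has to
    take care of that coupling. *)
Lemma normalized_energy_le u (p1 p2 a : R) :
  displacements N u -> 0 < l2norm N (D1 N u) ^+ 2 ->
  p2 * displacement_coupling N b u <= `|p2| * a * l2norm N (D1 N u) ^+ 2 ->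
  exists2 w, displacements N w /\ l2norm N (D1 N w) = 1 &
    inner N (Lbqcf N b p1 p2 w) w <= p1 + `|p2| * (8 + 2 * C + a).
Proof.
move=> du n_gt0 dle; have [pu zu] := du.
set L := l2norm N (D1 N u) in n_gt0 dle.
have L0 : 0 < L by rewrite lt0r sqrtr_ge0 andbT -(sqrf_eq0 L) gt_eqF.
exists (fun l => L^-1 * u l).
  split.
    split=> [l|]; first by rewrite pu.
    by apply/(zero_meanE N_gt0); rewrite dintZ (proj1 (zero_meanE N_gt0 u) zu) mulr0.
  apply/eqP; rewrite -(@eqrXn2 _ 2) ?sqrtr_ge0 // expr1n l2normE //.
  rewrite (eq_dint (fun l => L ^- 2 * D1 N u l ^+ 2)) => [|l].
    by rewrite dintZ -l2normE // -/L mulVf // gt_eqF.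
  by rewrite -exprVn /D1; ring.
rewrite bqcf_energyZ // exprVn mulrC ler_pdivrMr // bqcf_energyE // -/L.
have /ler_normlP[s1 s2] : `|strain_coupling N b u| <= 2 * C * L ^+ 2.
  apply: le_trans (strain_coupling_le pu) _; rewrite ler_wpM2r ?sqr_ge0 //.
  by rewrite ler_piMr ?inv_card_sqr_le1 // mulr_ge0.
have /andP[k1 k2] := blended_curvature_bounds pu.
move: s1 s2 dle k1 k2; rewrite -/L.
move: (L ^+ 2) n_gt0 (strain_coupling N b u) (displacement_coupling N b u)
  (blended_curvature N b u) => n n0 s d k s1 s2 dle k1 k2.
have : p2 * (4 * n - k + s) <= `|p2| * (4 * n + 2 * C * n).
  apply: le_trans (ler_norm _) _; rewrite normrM ler_wpM2l //.
  by rewrite ler_norml; apply/andP; split; lra.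
have : 0 <= `|p2| * n by rewrite mulr_ge0 // ltW.
by lra.
Qed.

Let S := test_norm_bound pi.
Let T := remainder_bound pi.

Lemma modulated_slope_bound_gt0 (V : R) : 0 < V -> 0 < modulated_slope_bound V.
Proof. by move=> V0; rewrite mulr_gt0 // ltr_wpDr // mulr_ge0. Qed.

Lemma test_norm_bound_gt0 (V : R) : 0 < V -> 0 < test_norm_bound V.
Proof.
move=> V0; rewrite ltr_wpDr ?mulr_ge0 ?sqr_ge0 // mulr_gt0 // exprn_gt0 //.
exact: modulated_slope_bound_gt0.
Qed.

Lemma remainder_bound_ge0 (V : R) : 0 < V -> 0 <= remainder_bound V.
Proof.
move=> V0; rewrite mulr_ge0 // addr_ge0 // mulr_ge0 ?sqr_ge0 //.
  by rewrite addr_ge0 // mulr_ge0.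
by rewrite ltW // modulated_slope_bound_gt0.
Qed.

(** Two regimes: if the rate is below twice the error T, any fixed wave works and
    the negative term is absorbed in the constant; otherwise the modulated wave
    has a coupling of the right sign and of size at least rate / 2 - T. *)
Lemma bqcf_unstable_mode (p1 p2 : R) :
  (exists l, b l = 0) -> (exists m, b m = 1) ->
  exists2 w, displacements N w /\ l2norm N (D1 N w) = 1 &
    inner N (Lbqcf N b p1 p2 w) w <=
      p1 + `|p2| * (8 + 2 * C + (4 * C * T + T / S - (2 * S)^-1 * rate)).
Proof.
move=> b0 b1; have r0 := root_width_gt0; have q0 := rate_gt0.
have S0 : 0 < S := test_norm_bound_gt0 (pi_gt0 R).
have T0 : 0 <= T := remainder_bound_ge0 (pi_gt0 R).
have TS : 0 <= T / S by rewrite divr_ge0 // ltW.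
have [qT|Tq] := leP (rate / 2) T.
  have [pv zv _] := waveP N_gt0 (@cosDpi R) lipschitz_cos.
  have du : displacements N (wave N (@cos R)) by split.
  have n0 : 0 < l2norm N (D1 N (wave N (@cos R))) ^+ 2.
    have := sup_norm_le 0 du.
    by rewrite /wave mulr0 mulr0 cos0 normr1 expr1n; lra.
  apply: (normalized_energy_le _ du n0); apply: le_trans (ler_norm _) _.
  rewrite normrM -mulrA ler_wpM2l //; apply: le_trans (displacement_coupling_le du) _.
  rewrite ler_wpM2r ?(ltW n0) //.
  have : (2 * S)^-1 * rate <= T / S.
    rewrite (_ : (2 * S)^-1 * rate = rate / 2 / S); last by field; rewrite gt_eqF.
    by rewrite ler_wpM2r // invr_ge0 ltW.
  have : 2 * C * rate <= 4 * C * T.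
    by rewrite (_ : 4 * C * T = 2 * C * (2 * T)); [rewrite ler_wpM2l ?mulr_ge0 //; lra|ring].
  by lra.
(* The sign for which p2 times the coupling is negative. *)
pose sg : R := if 0 <= p2 then -1 else 1.
have sg2 : sg ^+ 2 = 1 by rewrite /sg; case: ifP; rewrite ?sqrrN expr1n.
have p2E : p2 = - sg * `|p2|.
  rewrite /sg; case: (leP 0 p2) => [p20|p20]; first by rewrite opprK mul1r ger0_norm.
  by rewrite ltr0_norm // mulNr mul1r opprK.
pose A v := dint N (fun l => v (l - 1) ^+ 2 * D3 N b l ^+ 2).
have [f [vP v1 Af]] :
    exists f : R -> R, let v := wave N f in
  [/\ [/\ Defs.periodic N v, zero_mean N v & forall l, `|D1 N v l| <= pi],
      forall l, `|v l| <= 1 & r ^- 10 / 2 <= A v].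
  (* cos^2 + sin^2 = 1: one of the two waves carries half of the mass of
     |D3 b|^2, wherever that mass is located. *)
  have AA : r ^- 10 <= A (wave N cos) + A (wave N sin).
    rewrite /A -dintD; apply: le_trans (D3_sqr_ge b0 b1) _.
    rewrite (eq_dint (f := fun l => D3 N b l ^+ 2)
      (fun l => (wave N cos (l - 1) ^+ 2 * D3 N b l ^+ 2 +
                 wave N sin (l - 1) ^+ 2 * D3 N b l ^+ 2))) // => l.
    by rewrite -mulrDl cos2Dsin2 mul1r.
  have [Ac|Ac] := leP (r ^- 10 / 2) (A (wave N cos)).
    exists cos; split=> //; first exact: waveP N_gt0 (@cosDpi R) lipschitz_cos.
    by move=> l; apply: cos_max.
  exists sin; split=> //; first exact: waveP N_gt0 (@sinDpi R) lipschitz_sin.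
    by move=> l; apply: sin_max.
  by lra.
have [pv zv dv] := vP.
have [u [du nS sd]] := modulated_test_function pv zv v1 dv sg2.
have sdT : rate / 2 - T <= sg * displacement_coupling N b u.
  apply: le_trans sd; rewrite lerD2r.
  apply: (@le_trans _ _ (e ^+ 2 * r ^+ 5 * (r ^- 10 / 2))); last first.
    by rewrite ler_wpM2l // mulr_ge0 ?exprn_ge0 ?(ltW r0) ?(ltW e_gt0).
  by rewrite le_eqVlt /rate; apply/orP; left; apply/eqP; field; rewrite gt_eqF.
have n0 : 0 < l2norm N (D1 N u) ^+ 2.
  rewrite lt0r sqr_ge0 andbT; apply/eqP => nz.
  have := displacement_coupling_le du; rewrite nz mulr0 normr_le0 => /eqP dz.
  by move: sdT; rewrite dz mulr0; lra.
apply: (normalized_energy_le _ du n0); rewrite {1}p2E.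
move: (l2norm N _ ^+ 2) (displacement_coupling N b u) nS sdT n0 => n d nS sdT n0.
rewrite -/S in nS.
rewrite (_ : - sg * `|p2| * d = `|p2| * - (sg * d)); last by ring.
rewrite -mulrA ler_wpM2l //.
have : (rate / 2 - T) * (n / S) <= rate / 2 - T.
  by rewrite ler_piMr ?ler_pdivrMr ?mul1r //; lra.
have : 0 <= 4 * C * T * n.
  by apply: mulr_ge0 (ltW n0); apply: mulr_ge0 T0; apply: mulr_ge0.
have -> : (rate / 2 - T) * (n / S) = ((2 * S)^-1 * rate - T / S) * n by field; rewrite gt_eqF.
by lra.
Qed.

End BlendedEnergy.

(** * Real exponents and constants for arbitrary bounds *)

Lemma rateE (R : realType) (K e : R) : 0 < K -> 0 < e ->
  K `^ (- (5 / 2)) * e `^ (- (1 / 2)) = e ^+ 2 / Num.sqrt (K * e) ^+ 5.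
Proof.
move=> K0 e0; rewrite !powRN mul1r powR12_sqrt ?(ltW e0) //.
rewrite [5 / 2]mulrC powRrM powR12_sqrt ?(ltW K0) // powR_mulrn ?sqrtr_ge0 //.
rewrite sqrtrM ?(ltW K0) //.
have -> : e ^+ 2 = Num.sqrt e ^+ 4 by rewrite (exprM _ 2 2) sqr_sqrtr // ltW.
have a0 : Num.sqrt K != 0 by rewrite gt_eqF ?sqrtr_gt0.
have c0 : Num.sqrt e != 0 by rewrite gt_eqF ?sqrtr_gt0.
by field; rewrite a0 c0.
Qed.

(** The constants of the upper bound have to be positive whatever the sign of
    the given bound, hence they are built from its absolute value. *)
Lemma derivatives_bounded_norm (R : realType) (N : nat) (C : R) (b : int -> R) :
  derivatives_bounded N C b -> derivatives_bounded N `|C| b.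
Proof.
have h0 : 0 <= #|blending_region N b|%:R * eps R N by rewrite mulr_ge0 ?invr_ge0.
case=> H1 H2 H3.
by split; [apply: le_trans H1 _|apply: le_trans H2 _|apply: le_trans H3 _];
  rewrite ler_wpM2r ?ler_norm // invr_ge0 exprn_ge0.
Qed.

Theorem theorem2p1 (R : realType) (Cbeta : R) :
  exists C1 C2 C3 : R, 0 < C2 /\ 0 < C3 /\
  forall (N : nat) (phi : R -> R) (F : R) (beta : R -> R),
    let p1 : R := phi^`(2)%classic F in
    let p2 : R := phi^`(2)%classic (2 * F) in
    let b := sample N beta in
    let K := #|blending_region N b| in
    let q := K%:R `^ (- (5 / 2)) * eps R N `^ (- (1 / 2)) in
    let c0 := Num.min p1 (p1 + 4 * p2) in
    (1 <= N)%N ->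
    twice_differentiable_potential phi ->
    0 < F ->
    0 < p1 ->
    blending_function beta ->
    derivatives_supported N b ->
    (1 <= K)%N ->
    derivatives_bounded N Cbeta b ->
    (forall u : int -> R, displacements N u ->
       (c0 - C1 * `|p2| * q) * l2norm N (D1 N u) ^+ 2
         <= inner N (Lbqcf N b p1 p2 u) u) /\
    ((exists l : int, b l = 0) -> (exists m : int, b m = 1) ->
       (ereal_inf [set (inner N (Lbqcf N b p1 p2 u) u)%:E | u in
                     [set u | displacements N u /\ l2norm N (D1 N u) = 1%R]]
         <= (p1 + C2 * `|p2| - C3 * `|p2| * q)%:E)%E).
Proof.
pose C : R := `|Cbeta|; have C0 : 0 <= C by apply: normr_ge0.
pose S := test_norm_bound C pi; pose T := remainder_bound C pi.
have S0 : 0 < S := test_norm_bound_gt0 C0 (pi_gt0 R).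
have T0 : 0 <= T := remainder_bound_ge0 C0 (pi_gt0 R).
have TS : 0 <= T / S by rewrite divr_ge0 // ltW.
exists (6 * C), (8 + 2 * C + 4 * C * T + T / S), (2 * S)^-1.
split; first by have := mulr_ge0 C0 T0; lra.
split; first by rewrite invr_gt0 mulr_gt0.
move=> N phi F beta p1 p2 b K q c0 N0 _ _ _ [beta01 beta2] supp K0.
move=> /derivatives_bounded_norm bnd.
have pb : Defs.periodic N b.
  move=> l; rewrite /b /sample -[RHS]beta2 intrD mulrDr; congr (beta (_ + _)).
  by rewrite /eps -pmulrn natrM mulrCA mulVf ?mulr1 // pnatr_eq0 -lt0n.
have b01 l : 0 <= b l <= 1 by apply: beta01.
have -> : q = rate N b by apply: rateE; [rewrite ltr0n|exact: eps_gt0].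
split=> [u|b0 b1]; first exact: bqcf_coercive.
have [w dw wE] := bqcf_unstable_mode N0 C0 pb b01 supp K0 bnd p1 p2 b0 b1.
apply: (@le_trans _ _ (inner N (Lbqcf N b p1 p2 w) w)%:E).
  by apply: ereal_inf_lbound; exists w.
by rewrite lee_fin; apply: le_trans wE _; rewrite -/S -/T; lra.
Qed.
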